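(* Let $M$ be a generalized quasi-Einstein normal metric contact pair manifold. Then the Ricci tensor of $M$ is not of Codazzi type; that is, it is not the case that $(\nabla_{X_1}Ric)(X_2,X_3)-(\nabla_{X_2}Ric)(X_1,X_3)=0$ for all vector fields $X_1,X_2,X_3$ on $M$.
   Context: A contact pair of type $(p,q)$ ($p,q$ positive integers) on a differentiable manifold $M$ of dimension $m=2p+2q+2$ is a pair of $1$-forms $(\alpha_1,\alpha_2)$ with $\alpha_1\wedge(d\alpha_1)^p\wedge\alpha_2\wedge(d\alpha_2)^q\neq 0$ everywhere, $(d\alpha_1)^{p+1}=0$ and $(d\alpha_2)^{q+1}=0$. Its Reeb vector fields $Z_1,Z_2$ are the unique vector fields with $\alpha_i(Z_j)=\delta_{ij}$ and $i_{Z_i}d\alpha_j=0$ for $i,j\in\{1,2\}$. An almost contact pair structure is $(\alpha_1,\alpha_2,\phi)$ with $\phi$ a $(1,1)$-tensor field satisfying $\phi^2=-I+\alpha_1\otimes Z_1+\alpha_2\otimes Z_2$ and $\phi Z_1=\phi Z_2=0$ (then $\phi$ has rank $2p+2q$ and $\alpha_i\circ\phi=0$). Throughout, $\phi$ is assumed decomposable, i.e. $T\mathcal F_i=\ker\alpha_i\cap\ker d\alpha_i$ is $\phi$-invariant for $i=1,2$. A Riemannian metric $g$ is associated if $g(X,\phi Y)=(d\alpha_1+d\alpha_2)(X,Y)$ and $g(X,Z_i)=\alpha_i(X)$ for $i=1,2$; with such $g$, $(M,\phi,Z_1,Z_2,\alpha_1,\alpha_2,g)$ is a metric (almost) contact pair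 manifold. Here $d\alpha(X,Y)=\frac12\big(X\alpha(Y)-Y\alpha(X)-\alpha([X,Y])\big)$. It is normal if the almost complex structures $J=\phi-\alpha_2\otimes Z_1+\alpha_1\otimes Z_2$ and $T=\phi+\alpha_2\otimes Z_1-\alpha_1\otimes Z_2$ are both integrable. $\nabla$ is the Levi-Civita connection of $g$ and $Ric$ its Ricci tensor. A normal metric contact pair manifold is generalized quasi-Einstein if there are functions $\lambda,\beta,\mu$ on $M$ with $Ric(X_1,X_2)=\lambda g(X_1,X_2)+\beta\alpha_1(X_1)\alpha_1(X_2)+\mu\alpha_2(X_1)\alpha_2(X_2)$ for all $X_1,X_2\in\Gamma(TM)$; here the coefficients $\beta$ and $\mu$ are required to be non-zero (not identically zero). (Necessarily $\beta=2p-\lambda$ and $\mu=2q-\lambda$.) *)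

(* Defs.v *)
From HB Require Import structures.
From mathcomp Require Import all_boot all_order all_algebra perm.
From mathcomp Require Import all_classical all_reals all_analysis.

Set Implicit Arguments.
Unset Strict Implicit.
Unset Printing Implicit Defensive.

Import Order.TTheory GRing.Theory Num.Theory.
Import numFieldNormedType.Exports.
Local Open Scope classical_set_scope.
Local Open Scope ring_scope.

(* [Ck k U f], for U open: the partial derivatives of f of order at most k
   exist and are continuous on U. *)
Fixpoint Ck (R : realType) (n k : nat) (U : set 'rV[R]_n)
    (f : 'rV[R]_n -> R) : Prop :=
  (forall x, U x -> {for x, continuous f}) /\
  if k is k'.+1 then
    forall i : 'I_n, (forall x, U x -> derivable f x (delta_mx 0 i)) /\
                     Ck k' U ('D_(delta_mx 0 i) f)
  else True.

Definition Cinf (R : realType) (n : nat) (U : set 'rV[R]_n)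
    (f : 'rV[R]_n -> R) : Prop :=
  forall k, Ck k U f.

Section CkTheory.
Context (R : realType) (n : nat) (U : set 'rV[R]_n) (openU : open U).
Implicit Types f g : 'rV[R]_n -> R.

Lemma near_eq_open f g x : (forall y, U y -> f y = g y) -> U x ->
  \forall y \near x, f y = g y.
Proof.
move=> fg Ux; apply: (@filterS _ (nbhs x) _ _ _ fg).
exact: open_nbhs_nbhs.
Qed.

Lemma eq_Ck k f g : (forall y, U y -> f y = g y) -> Ck k U f -> Ck k U g.
Proof.
elim: k f g => [|k IHk] f g fg.
  move=> [fc _]; split=> // x Ux; have nfg := near_eq_open fg Ux.
  rewrite /prop_for /continuous_at -(fg x Ux).
  exact: cvg_trans (near_eq_cvg nfg) (fc x Ux).
move=> [fc fd]; split=> [x Ux|i].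
  have nfg := near_eq_open fg Ux.
  rewrite /prop_for /continuous_at -(fg x Ux).
  exact: cvg_trans (near_eq_cvg nfg) (fc x Ux).
have [df cf] := fd i; split=> [x Ux|].
  exact: near_eq_derivable (near_eq_open fg Ux) (df x Ux).
apply: IHk cf => x Ux.
exact: near_eq_derive (near_eq_open fg Ux).
Qed.

Lemma CkW k f : Ck k.+1 U f -> Ck k U f.
Proof.
elim: k f => [|k IHk] f [fc fd]; split=> // i.
by have [df cf] := fd i; split=> //; exact: IHk.
Qed.

Lemma Ck_cst k (a : R) : Ck k U (cst a).
Proof.
elim: k a => [|k IHk] a; split=> //; try by move=> x _; exact: cst_continuous.
move=> i; split=> [x _|]; first exact: derivable_cst.
by apply: eq_Ck _ (IHk 0) => x _; rewrite derive_cst.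
Qed.

Lemma CkD k f g : Ck k U f -> Ck k U g -> Ck k U (f + g).
Proof.
elim: k f g => [|k IHk] f g [fc fd] [gc gd]; split=> //;
  try by move=> x Ux; apply: continuousD; [exact: fc|exact: gc].
move=> i; have [df cf] := fd i; have [dg cg] := gd i; split=> [x Ux|].
  by apply: derivableD; [exact: df|exact: dg].
apply: eq_Ck _ (IHk _ _ cf cg) => x Ux.
by rewrite deriveD; [|exact: df|exact: dg].
Qed.

Lemma CkM k f g : Ck k U f -> Ck k U g -> Ck k U (f * g).
Proof.
elim: k f g => [|k IHk] f g hf hg; have [fc fd] := hf; have [gc gd] := hg;
  split=> //; try by move=> x Ux; apply: continuousM; [exact: fc|exact: gc].
move=> i; have [df cf] := fd i; have [dg cg] := gd i; split=> [x Ux|].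
  by apply: derivableM; [exact: df|exact: dg].
apply: eq_Ck _ (CkD (IHk _ _ (CkW hf) cg) (IHk _ _ (CkW hg) cf)) => x Ux.
by rewrite deriveM; [|exact: df|exact: dg].
Qed.

End CkTheory.

Record chart (R : realType) (m : nat) (T : topologicalType) := Chart {
  chart_dom : set T;
  chart_map :> T -> 'rV[R]_m;
  chart_inv : 'rV[R]_m -> T; (* only meaningful on the image of the chart *)
  chart_dom_open : open chart_dom;
  chart_img_open : open (chart_map @` chart_dom);
  chart_mapK : forall x, chart_dom x -> chart_inv (chart_map x) = x;
  chart_map_cont : forall x, chart_dom x -> {for x, continuous chart_map};
  chart_inv_cont :
    forall y, (chart_map @` chart_dom) y -> {for y, continuous chart_inv} }.

Arguments chart_img_open {R m T} c.

Definition smooth_transition (R : realType) (m : nat) (T : topologicalType)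
    (c d : chart R m T) : Prop :=
  forall j : 'I_m, Cinf (c @` (chart_dom c `&` chart_dom d))
                        (fun y => d (chart_inv c y) 0 j).

Record manifold (R : realType) (m : nat) := Manifold {
  carrier :> topologicalType;
  manifold_hausdorff : hausdorff_space carrier;
  manifold_second_countable : @second_countable carrier;
  atlas : set (chart R m carrier);
  atlas_cover : forall x, exists2 c, atlas c & chart_dom c x;
  atlas_compatible :
    forall c d, atlas c -> atlas d -> smooth_transition c d }.

Definition compatible_chart (R : realType) (m : nat) (M : manifold R m)
    (c : chart R m M) : Prop :=
  forall d, atlas d -> smooth_transition c d /\ smooth_transition d c.

Definition smooth (R : realType) (m : nat) (M : manifold R m) (f : M -> R) :
    Prop :=
  forall c, atlas c -> Cinf (c @` chart_dom c) (f \o chart_inv c).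

Definition smooth_pred (R : realType) (m : nat) (M : manifold R m) :
  {pred M -> R} := fun f => `[< smooth f >].

Section SmoothAlgebra.
Context (R : realType) (m : nat) (M : manifold R m).

Lemma smooth_cst (a : R) : smooth (cst a : M -> R).
Proof. by move=> c _ k; exact: (Ck_cst (chart_img_open c) k a). Qed.

Lemma smoothD (f g : M -> R) : smooth f -> smooth g -> smooth (f + g).
Proof.
move=> sf sg c cA k.
exact: (CkD (chart_img_open c) (sf c cA k) (sg c cA k)).
Qed.

Lemma smoothM (f g : M -> R) : smooth f -> smooth g -> smooth (f * g).
Proof.
move=> sf sg c cA k.
exact: (CkM (chart_img_open c) (sf c cA k) (sg c cA k)).
Qed.

Lemma smoothZ (a : R) (f : M -> R) : smooth f -> smooth (a *: f).
Proof. exact: (smoothM (smooth_cst a)). Qed.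

Lemma smooth_subring_closed : subring_closed (@smooth_pred R m M).
Proof.
split=> [|f g /asboolP sf /asboolP sg|f g /asboolP sf /asboolP sg].
- by apply/asboolP; exact: smooth_cst.
- by apply/asboolP; rewrite -scaleN1r; apply: smoothD => //; exact: smoothZ.
- by apply/asboolP; exact: smoothM.
Qed.

Lemma smooth_scaler_closed : GRing.scaler_closed (@smooth_pred R m M).
Proof. by move=> a f /asboolP sf; apply/asboolP; exact: smoothZ. Qed.

HB.instance Definition _ :=
  GRing.isSubringClosed.Build (M -> R) (@smooth_pred R m M)
    smooth_subring_closed.
HB.instance Definition _ :=
  GRing.isScaleClosed.Build R (M -> R) (@smooth_pred R m M)
    smooth_scaler_closed.

Record smoothfun := SmoothFun {
  smoothfun_val :> M -> R;
  smoothfunP : smoothfun_val \in @smooth_pred R m M }.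

HB.instance Definition _ := [isSub for smoothfun_val].
HB.instance Definition _ := [Choice of smoothfun by <:].
HB.instance Definition _ :=
  GRing.SubChoice_isSubComPzRing.Build (M -> R) (@smooth_pred R m M) smoothfun
    (GRing.subringClosedP _).
HB.instance Definition _ := [SubZmodule_isSubLmodule of smoothfun by <:].

Lemma smoothfunDE (f g : smoothfun) (x : M) : (f + g) x = f x + g x.
Proof. by []. Qed.

Lemma smoothfunNE (f : smoothfun) (x : M) : (- f) x = - f x.
Proof. by []. Qed.

Lemma smoothfunME (f g : smoothfun) (x : M) : (f * g) x = f x * g x.
Proof. by []. Qed.

Lemma smoothfunZE (a : R) (f : smoothfun) (x : M) : (a *: f) x = a * f x.
Proof. by []. Qed.

Lemma smoothfun1E (x : M) : (1 : smoothfun) x = 1.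
Proof. by []. Qed.

Lemma smoothfun_scaleAl (a : R) (f g : smoothfun) : a *: f * g = a *: (f * g).
Proof. by apply/val_inj/funext => x /=; exact/esym/mulrA. Qed.

Lemma smoothfun_scaleAr (a : R) (f g : smoothfun) : f * (a *: g) = a *: (f * g).
Proof. by rewrite mulrC smoothfun_scaleAl mulrC. Qed.

End SmoothAlgebra.

Arguments smoothfun {R m} M.

(* Vector fields are encoded as the R-linear derivations of C^oo(M). *)

Record vfield (R : realType) (m : nat) (M : manifold R m) := VField {
  vfield_fun :> smoothfun M -> smoothfun M;
  vfield_linear : linear vfield_fun;
  vfield_leibniz :
    forall f g, vfield_fun (f * g) = vfield_fun f * g + f * vfield_fun g }.

Section VectorFields.
Context (R : realType) (m : nat) (M : manifold R m).
Implicit Types (X Y : vfield M) (f : smoothfun M).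

Lemma vfieldP X Y : (forall f, X f = Y f) -> X = Y.
Proof.
case: X Y => [X lX LX] [Y lY LY] /= /funext XY; rewrite -{}XY in lY LY *.
by congr VField; exact: Prop_irrelevance.
Qed.

Lemma vfieldZ X (a : R) f : X (a *: f) = a *: X f.
Proof.
have X0 : X 0 = 0.
  apply: (@addrI _ (X 0)); rewrite addr0.
  by have := vfield_linear X 1 0 0; rewrite !scale1r addr0.
by rewrite -[a *: f]addr0 vfield_linear X0 addr0.
Qed.

Lemma vfieldD X f g : X (f + g) = X f + X g.
Proof. by rewrite -[f]scale1r vfield_linear !scale1r. Qed.

Lemma vfieldB X f g : X (f - g) = X f - X g.
Proof. by rewrite -scaleN1r vfieldD vfieldZ scaleN1r. Qed.

Lemma vfield0_linear : linear (fun f => 0 : smoothfun M).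
Proof. by move=> a f g; rewrite scaler0 addr0. Qed.

Lemma vfield0_leibniz f g : (0 : smoothfun M) = 0 * g + f * 0.
Proof. by rewrite mul0r mulr0 addr0. Qed.

Definition vfield_zero := VField vfield0_linear vfield0_leibniz.

Lemma vfieldN_linear X : linear (fun f => - X f).
Proof. by move=> a f g; rewrite vfield_linear opprD scalerN. Qed.

Lemma vfieldN_leibniz X f g : - X (f * g) = - X f * g + f * - X g.
Proof. by rewrite vfield_leibniz opprD mulNr mulrN. Qed.

Definition vfield_opp X := VField (vfieldN_linear X) (vfieldN_leibniz X).

Lemma vfieldD_linear X Y : linear (fun f => X f + Y f).
Proof. by move=> a f g; rewrite !vfield_linear scalerDr addrACA. Qed.

Lemma vfieldD_leibniz X Y f g :
  X (f * g) + Y (f * g) = (X f + Y f) * g + f * (X g + Y g).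
Proof. by rewrite !vfield_leibniz mulrDl mulrDr addrACA. Qed.

Definition vfield_add X Y :=
  VField (vfieldD_linear X Y) (vfieldD_leibniz X Y).

Lemma vfieldM_linear f X : linear (fun g => f * X g).
Proof. by move=> a g h; rewrite vfield_linear mulrDr smoothfun_scaleAr. Qed.

Lemma vfieldM_leibniz f X g h : f * X (g * h) = f * X g * h + g * (f * X h).
Proof. by rewrite vfield_leibniz mulrDr mulrA [g * (f * _)]mulrCA. Qed.

Definition vfield_scale f X := VField (vfieldM_linear f X) (vfieldM_leibniz f X).

HB.instance Definition _ := gen_eqMixin (vfield M).
HB.instance Definition _ := gen_choiceMixin (vfield M).

Lemma vfield_addA : associative vfield_add.
Proof. by move=> X Y Z; apply: vfieldP => f /=; rewrite addrA. Qed.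

Lemma vfield_addC : commutative vfield_add.
Proof. by move=> X Y; apply: vfieldP => f /=; rewrite addrC. Qed.

Lemma vfield_add0 : left_id vfield_zero vfield_add.
Proof. by move=> X; apply: vfieldP => f /=; rewrite add0r. Qed.

Lemma vfield_addN : left_inverse vfield_zero vfield_opp vfield_add.
Proof. by move=> X; apply: vfieldP => f /=; rewrite addNr. Qed.

HB.instance Definition _ := GRing.isZmodule.Build (vfield M)
  vfield_addA vfield_addC vfield_add0 vfield_addN.

Lemma vfield_scaleA f g X :
  vfield_scale f (vfield_scale g X) = vfield_scale (f * g) X.
Proof. by apply: vfieldP => h /=; rewrite mulrA. Qed.

Lemma vfield_scale1 : left_id 1 vfield_scale.
Proof. by move=> X; apply: vfieldP => f /=; rewrite mul1r. Qed.

Lemma vfield_scaleDr : right_distributive vfield_scale +%R.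
Proof. by move=> f X Y; apply: vfieldP => g /=; rewrite mulrDr. Qed.

Lemma vfield_scaleDl X :
  {morph vfield_scale^~ X : f g / f + g >-> f + g}.
Proof. by move=> f g; apply: vfieldP => h /=; rewrite mulrDl. Qed.

HB.instance Definition _ := GRing.Zmodule_isLmodule.Build
  (smoothfun M) (vfield M) vfield_scaleA vfield_scale1 vfield_scaleDr
  vfield_scaleDl.

Lemma bracket_linear X Y : linear (fun f => X (Y f) - Y (X f)).
Proof. by move=> a f g; rewrite !vfield_linear scalerBr opprD addrACA. Qed.

Lemma bracket_leibniz X Y f g :
  X (Y (f * g)) - Y (X (f * g)) =
  (X (Y f) - Y (X f)) * g + f * (X (Y g) - Y (X g)).
Proof.
rewrite !vfield_leibniz !vfieldD !vfield_leibniz mulrBl mulrBr.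
set a := X (Y f) * g; set b := Y f * X g; set c := X f * Y g.
set d := f * X (Y g); set e := Y (X f) * g; set h := f * Y (X g).
rewrite !opprD !addrA.
by rewrite (AC 8 ((1*5)*(4*8)*(2*7)*(3*6))) /= !subrr !addr0 addrA.
Qed.

Definition bracket X Y := VField (bracket_linear X Y) (bracket_leibniz X Y).

End VectorFields.

Section Geometry.
Context (R : realType) (m : nat) (M : manifold R m).
Implicit Types (X Y Z W : vfield M) (f : smoothfun M) (x : M).

Definition vfield_nonzero_at X x : Prop := exists f, X f x != 0.

(* A k-form is given by its values on k-tuples of vector fields; all the forms
   below are obtained from C^oo(M)-linear 1-forms by [dform] and [wedge], and
   are therefore multilinear and alternating. *)
Definition form (k : nat) := ('I_k -> vfield M) -> smoothfun M.

Definition dform (a : {scalar vfield M}) X Y : smoothfun M :=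
  2^-1 *: (X (a Y) - Y (a X) - a (bracket X Y)).

Definition form1 (a : {scalar vfield M}) : form 1 :=
  fun V : 'I_1 -> vfield M => a (V ord0).

Definition form2 (w : vfield M -> vfield M -> smoothfun M) : form 2 :=
  fun V : 'I_2 -> vfield M => w (V ord0) (V ord_max).

(* The factor 1/(k+l)! is the one that goes with the factor 1/2 in [dform]. *)
Definition wedge (k l : nat) (w : form k) (h : form l) : form (k + l) :=
  fun V : 'I_(k + l) -> vfield M => ((k + l)`!%:R^-1 : R) *:
    \sum_(s : 'S_(k + l)) ((-1) ^+ s : R) *:
      (w (fun i => V (s (lshift l i))) * h (fun j => V (s (rshift k j)))).

Fixpoint wedge_pow (w : form 2) (k : nat) : form (k * 2) :=
  match k return form (k * 2) with
  | 0 => fun _ => 1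
  | k'.+1 => wedge w (@wedge_pow w k')
  end.

Definition vanishes (k : nat) (w : form k) : Prop := forall V : 'I_k -> vfield M, w V = 0.

Definition nowhere_zero (k : nat) (w : form k) : Prop :=
  forall x, exists V : 'I_k -> vfield M, w V x != 0.

Record riemannian_metric := RiemannianMetric {
  metric :> vfield M -> vfield M -> smoothfun M;
  metric_scalar : forall Y, scalar (metric^~ Y);
  metric_sym : forall X Y, metric X Y = metric Y X;
  metric_pos : forall X x, vfield_nonzero_at X x -> 0 < metric X X x }.

Record affine_connection := AffineConnection {
  nabla :> vfield M -> vfield M -> vfield M;
  nabla_linear : forall Y, linear (nabla^~ Y);
  nablaD : forall X Y Z, nabla X (Y + Z) = nabla X Y + nabla X Z;
  nabla_leibniz : forall X f Y, nabla X (f *: Y) = X f *: Y + f *: nabla X Y }.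

Definition levi_civita (g : riemannian_metric) (D : affine_connection) : Prop :=
  (forall X Y, D X Y - D Y X = bracket X Y) /\
  (forall X Y Z, X (g Y Z) = g (D X Y) Z + g Y (D X Z)).

Definition curvature (D : affine_connection) X Y Z : vfield M :=
  D X (D Y Z) - D Y (D X Z) - D (bracket X Y) Z.

Definition orthonormal_at (g : riemannian_metric) x (E : 'I_m -> vfield M) :
    Prop :=
  forall i j, g (E i) (E j) x = (i == j)%:R.

(* [Ric X Y] at x is the trace of Z |-> curvature Z X Y, computed in any family
   of vector fields whose values at x form an orthonormal basis of T_x M. *)
Definition ricci_tensor (g : riemannian_metric) (D : affine_connection)
    (Ric : vfield M -> vfield M -> smoothfun M) : Prop :=
  forall x E, orthonormal_at g x E ->
  forall X Y, Ric X Y x = \sum_(i < m) g (curvature D (E i) X Y) (E i) x.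

Definition nabla2 (D : affine_connection)
    (S : vfield M -> vfield M -> smoothfun M) X Y Z : smoothfun M :=
  X (S Y Z) - S (D X Y) Z - S Y (D X Z).

Definition codazzi_type (D : affine_connection)
    (S : vfield M -> vfield M -> smoothfun M) : Prop :=
  forall X1 X2 X3, nabla2 D S X1 X2 X3 - nabla2 D S X2 X1 X3 = 0.

(* J is induced by a complex structure on M: around every point there is a
   chart of M with coordinates (u_1, .., u_n, v_1, .., v_n) such that the
   functions u_j + i v_j satisfy the Cauchy-Riemann equations
   d(u_j + i v_j) o J = i d(u_j + i v_j). The coordinates are required to
   extend to smooth functions on M, so that vector fields act on them; this can
   always be achieved by shrinking the domain of the chart. *)
Definition integrable (J : vfield M -> vfield M) : Prop :=
  forall x, exists (n : nat) (e : m = (n + n)%N) (c : chart R m M)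
                   (u v : 'I_n -> smoothfun M),
  [/\ compatible_chart c, chart_dom c x,
      forall y, chart_dom c y ->
        castmx (erefl 1%N, e) (c y) = row_mx (\row_j u j y) (\row_j v j y) &
      forall y, chart_dom c y -> forall X j,
        J X (u j) y = - X (v j) y /\ J X (v j) y = X (u j) y].

End Geometry.

Arguments wedge_pow {R m M} w k _.

Section ContactPairs.
Context (R : realType) (p q : nat) (M : manifold R (2 * p + 2 * q + 2)).
Implicit Types (a : {scalar vfield M}) (Z X Y : vfield M).

Record contact_pair a1 a2 : Prop := ContactPair {
  contact_pair_volume :
    nowhere_zero (wedge (wedge (wedge (form1 a1) (wedge_pow (form2 (dform a1)) p))
                               (form1 a2))
                        (wedge_pow (form2 (dform a2)) q));
  contact_pair_rank1 : vanishes (wedge_pow (form2 (dform a1)) p.+1);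
  contact_pair_rank2 : vanishes (wedge_pow (form2 (dform a2)) q.+1) }.

Record reeb_fields a1 a2 Z1 Z2 : Prop := ReebFields {
  reeb_dual : [/\ a1 Z1 = 1, a1 Z2 = 0, a2 Z1 = 0 & a2 Z2 = 1];
  reeb_dform1 : forall X, dform a1 Z1 X = 0 /\ dform a1 Z2 X = 0;
  reeb_dform2 : forall X, dform a2 Z1 X = 0 /\ dform a2 Z2 X = 0 }.

Record almost_contact_pair_structure a1 a2 Z1 Z2
    (phi : {linear vfield M -> vfield M}) : Prop := AlmostContactPairStructure {
  acps_contact_pair : contact_pair a1 a2;
  acps_reeb : reeb_fields a1 a2 Z1 Z2;
  acps_sqr : forall X, phi (phi X) = - X + a1 X *: Z1 + a2 X *: Z2;
  acps_ker : phi Z1 = 0 /\ phi Z2 = 0 }.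

(* The value of X at x lies in the fibre at x of ker a and of ker (d a). *)
Definition in_char_distr (a : {scalar vfield M}) X (x : M) : Prop :=
  a X x = 0 /\ forall Y, dform a X Y x = 0.

Definition decomposable a1 a2 (phi : {linear vfield M -> vfield M}) : Prop :=
  forall X x, (in_char_distr a1 X x -> in_char_distr a1 (phi X) x) /\
              (in_char_distr a2 X x -> in_char_distr a2 (phi X) x).

Definition associated_metric a1 a2 Z1 Z2 (phi : {linear vfield M -> vfield M})
    (g : riemannian_metric M) : Prop :=
  (forall X Y, g X (phi Y) = dform a1 X Y + dform a2 X Y) /\
  (forall X, g X Z1 = a1 X /\ g X Z2 = a2 X).

Definition acps_J a1 a2 Z1 Z2 (phi : {linear vfield M -> vfield M}) X :
    vfield M :=
  phi X - a2 X *: Z1 + a1 X *: Z2.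

Definition acps_T a1 a2 Z1 Z2 (phi : {linear vfield M -> vfield M}) X :
    vfield M :=
  phi X + a2 X *: Z1 - a1 X *: Z2.

Record normal_metric_contact_pair a1 a2 Z1 Z2
    (phi : {linear vfield M -> vfield M}) (g : riemannian_metric M) : Prop :=
  NormalMetricContactPair {
    nmcp_structure : almost_contact_pair_structure a1 a2 Z1 Z2 phi;
    nmcp_decomposable : decomposable a1 a2 phi;
    nmcp_associated : associated_metric a1 a2 Z1 Z2 phi g;
    nmcp_normal : integrable (acps_J a1 a2 Z1 Z2 phi) /\
                  integrable (acps_T a1 a2 Z1 Z2 phi) }.

Definition generalized_quasi_einstein a1 a2 (g : riemannian_metric M)
    (Ric : vfield M -> vfield M -> smoothfun M) : Prop :=
  exists lambda beta mu : smoothfun M,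
    [/\ beta != 0, mu != 0 &
        forall X1 X2, Ric X1 X2 =
          lambda * g X1 X2 + beta * a1 X1 * a1 X2 + mu * a2 X1 * a2 X2].

End ContactPairs.

(* Main.v *)
Require Import Defs.
From HB Require Import structures.
From mathcomp Require Import all_boot all_order all_algebra perm.
From mathcomp Require Import all_classical all_reals all_analysis.
From mathcomp Require Import ring.

(** Write the Ricci tensor as lambda g + beta a1 a1 + mu a2 a2, where a1 and a2
    are the two contact forms. Covariant differentiation of a1, antisymmetrized,
    gives 2 d a1 because the connection is torsion free; hence, for X and Y in
    the kernels of a1 and a2, the Codazzi expression of the Ricci tensor at
    (X, Y, Z1) collapses to 2 beta (d a1)(X, Y): the term in mu disappears
    because a2 Z1 = 0, and the terms in X lambda, Y lambda because X and Y are
    orthogonal to Z1 ([codazzi_horizontal]).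

    If the Ricci tensor is of Codazzi type, beta (d a1) therefore vanishes on
    horizontal fields. The form d a1 is C^oo(M)-bilinear and is annihilated by
    the Reeb fields, so beta (d a1) vanishes identically
    ([dform_horizontal_part]). As beta is not the zero function, d a1 is zero at
    some point; since p > 0, so is the volume form of the contact pair, which is
    the contradiction. *)

Set Implicit Arguments.
Unset Strict Implicit.
Unset Printing Implicit Defensive.

Import GRing.Theory Num.Theory.
Local Open Scope ring_scope.

Section PointwiseForms.
Context (R : realType) (m : nat) (M : manifold R m).

Lemma smoothfun_neq0 (f : smoothfun M) : f != 0 -> exists x, f x != 0.
Proof.
move=> f0; apply: contrapT => nx; move/eqP: f0; apply.
apply/val_inj/funext => x; apply: contrapT => /eqP fx.
by apply: nx; exists x.
Qed.

Lemma smoothfun_sum0 (I : finType) (F : I -> smoothfun M) (x : M) :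
  (forall i, F i x = 0) -> (\sum_i F i) x = 0.
Proof.
move=> F0; apply: (big_ind (fun f : smoothfun M => f x = 0)) => //.
by move=> f h fx hx; rewrite smoothfunDE fx hx addr0.
Qed.

Definition form_zero_at (k : nat) (w : Defs.form M k) (x : M) : Prop :=
  forall V : 'I_k -> vfield M, w V x = 0.

Lemma wedge_zero_at_l (k l : nat) (w : Defs.form M k) (h : Defs.form M l) (x : M) :
  form_zero_at w x -> form_zero_at (Defs.wedge w h) x.
Proof.
move=> w0 V; rewrite /Defs.wedge smoothfunZE smoothfun_sum0 ?mulr0 // => s.
by rewrite smoothfunZE smoothfunME w0 mul0r mulr0.
Qed.

Lemma wedge_zero_at_r (k l : nat) (w : Defs.form M k) (h : Defs.form M l) (x : M) :
  form_zero_at h x -> form_zero_at (Defs.wedge w h) x.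
Proof.
move=> h0 V; rewrite /Defs.wedge smoothfunZE smoothfun_sum0 ?mulr0 // => s.
by rewrite smoothfunZE smoothfunME h0 !mulr0.
Qed.

Lemma wedge_pow_zero_at (w : Defs.form M 2) (k : nat) (x : M) :
  (0 < k)%N -> form_zero_at w x -> form_zero_at (wedge_pow w k) x.
Proof. by case: k => // k _; exact: wedge_zero_at_l. Qed.

End PointwiseForms.

Lemma vfield0 (R : realType) (m : nat) (M : manifold R m) (X : vfield M) :
  X 0 = 0.
Proof. by have := vfieldB X 0 0; rewrite !subrr. Qed.

Section ExteriorDerivative.
Context (R : realType) (m : nat) (M : manifold R m).
Variable a : {scalar vfield M}.
Implicit Types (X Y Z : vfield M) (f : smoothfun M).

Lemma scalar_formZ f X : a (f *: X) = f * a X.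
Proof. exact: linearZ. Qed.

Lemma dformC X Y : dform a X Y = - dform a Y X.
Proof.
rewrite /dform; have -> : bracket X Y = - bracket Y X.
  by apply: vfieldP => f /=; rewrite opprB.
by rewrite (raddfN a) -scalerN; congr (_ *: _); ring.
Qed.

Lemma dformDl X X' Y : dform a (X + X') Y = dform a X Y + dform a X' Y.
Proof.
rewrite /dform; have -> : bracket (X + X') Y = bracket X Y + bracket X' Y.
  by apply: vfieldP => f /=; rewrite vfieldD; ring.
rewrite !(raddfD a) vfieldD /= -scalerDr; congr (_ *: _); ring.
Qed.

(** The derivatives of f produced by Y (a (f X)) and by the bracket of f X
    and Y cancel. *)
Lemma dformZl f X Y : dform a (f *: X) Y = f * dform a X Y.
Proof.
rewrite /dform; have -> : bracket (f *: X) Y = f *: bracket X Y - Y f *: X.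
  by apply: vfieldP => h /=; rewrite vfield_leibniz; ring.
rewrite (raddfB a) /= !scalar_formZ vfield_leibniz smoothfun_scaleAr.
by congr (_ *: _); rewrite /=; ring.
Qed.

Lemma dformBl_annihilated f Z X Y :
  (forall W, dform a Z W = 0) -> dform a (X - f *: Z) Y = dform a X Y.
Proof. by move=> Z0; rewrite -scaleNr dformDl dformZl Z0 mulr0 addr0. Qed.

Lemma dformBr_annihilated f Z X Y :
  (forall W, dform a Z W = 0) -> dform a X (Y - f *: Z) = dform a X Y.
Proof. by move=> Z0; rewrite dformC dformBl_annihilated // -dformC. Qed.

End ExteriorDerivative.

Section Horizontal.
Context (R : realType) (m : nat) (M : manifold R m).
Variables (a1 a2 : {scalar vfield M}) (Z1 Z2 : vfield M).
Implicit Types (X Y : vfield M).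

Definition horizontal X : Prop := a1 X = 0 /\ a2 X = 0.

Definition horizontal_part X : vfield M := X - a1 X *: Z1 - a2 X *: Z2.

Lemma horizontal_part_horizontal X :
  [/\ a1 Z1 = 1, a1 Z2 = 0, a2 Z1 = 0 & a2 Z2 = 1] ->
  horizontal (horizontal_part X).
Proof.
by case=> e11 e12 e21 e22; split;
  rewrite /horizontal_part !raddfB /= !scalar_formZ ?e11 ?e12 ?e21 ?e22; ring.
Qed.

Lemma dform_horizontal_part X Y :
  (forall W, dform a1 Z1 W = 0 /\ dform a1 Z2 W = 0) ->
  dform a1 (horizontal_part X) (horizontal_part Y) = dform a1 X Y.
Proof.
move=> dZ; have [dZ1 dZ2] := all_and2 dZ.
by rewrite !dformBl_annihilated // !dformBr_annihilated.
Qed.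

Lemma dform_horizontal X Y : horizontal X -> horizontal Y ->
  a1 (bracket X Y) = - (dform a1 X Y + dform a1 X Y).
Proof.
move=> [X1 _] [Y1 _]; rewrite /dform X1 Y1.
rewrite !vfield0 subrr sub0r -scalerDl.
have -> : (2^-1 + 2^-1 : R) = 1 by field.
by rewrite scale1r opprK.
Qed.

(** By metricity, g(Y, D_X Z1) = - a1 (D_X Y) for Y orthogonal to Z1, and the
    only part of S that S(Y, D_X Z1) sees is l g; against Z1 itself S takes the
    value (l + b) a1. Antisymmetrization in X and Y leaves the difference b in
    front of - a1 (D_X Y - D_Y X), where torsion-freeness brings in the bracket
    of X and Y. *)
Lemma codazzi_horizontal (g : riemannian_metric M) (D : affine_connection M)
    (S : vfield M -> vfield M -> smoothfun M) (l b u : smoothfun M) X Y :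
  levi_civita g D ->
  (forall W, g W Z1 = a1 W) -> a1 Z1 = 1 -> a2 Z1 = 0 ->
  (forall V W, S V W = l * g V W + b * a1 V * a1 W + u * a2 V * a2 W) ->
  horizontal X -> horizontal Y ->
  nabla2 D S X Y Z1 - nabla2 D S Y X Z1 =
  b * (dform a1 X Y + dform a1 X Y).
Proof.
move=> [torsion metricity] gZ1 e11 e21 SE hX hY.
have SZ1 W : S W Z1 = (l + b) * a1 W.
  by rewrite SE gZ1 e11 e21; ring.
have SDZ1 V W : horizontal W -> S W (D V Z1) = - (l * a1 (D V W)).
  move=> [W1 W2]; rewrite SE W1 W2.
  have := metricity V W Z1; rewrite !gZ1 W1 vfield0 => /esym/eqP.
  by rewrite addrC addr_eq0 => /eqP ->; ring.
rewrite /nabla2 !SDZ1 // !SZ1.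
have [X1 _] := hX; have [Y1 _] := hY; rewrite X1 Y1 mulr0 !vfield0.
have := dform_horizontal hX hY; rewrite -torsion raddfB /= => dE.
rewrite -[dform a1 X Y + _]opprK -dE; ring.
Qed.

End Horizontal.

Theorem theorem5p2 (R : realType) (p q : nat) (hp : (0 < p)%N) (hq : (0 < q)%N)
    (M : manifold R (2 * p + 2 * q + 2))
    (alpha1 alpha2 : {scalar vfield M}) (Z1 Z2 : vfield M)
    (phi : {linear vfield M -> vfield M}) (g : riemannian_metric M)
    (D : affine_connection M) (Ric : vfield M -> vfield M -> smoothfun M)
    (hM : normal_metric_contact_pair alpha1 alpha2 Z1 Z2 phi g)
    (hD : levi_civita g D) (hRic : ricci_tensor g D Ric)
    (hQE : generalized_quasi_einstein alpha1 alpha2 g Ric) :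
  ~ codazzi_type D Ric.
Proof.
move=> codazzi.
have [lambda [beta [mu [beta0 _ RicE]]]] := hQE.
have [[[volume _ _] [dual dZ _] _ _] _ [_ gZ] _] := hM.
have [gZ1 _] := all_and2 gZ; have [e11 _ e21 _] := dual.
have [x bx] := smoothfun_neq0 beta0.
have d1x : form_zero_at (form2 (dform alpha1)) x.
  move=> V; rewrite /form2 -(dform_horizontal_part alpha2 _ _ dZ).
  set X := horizontal_part _ _ _ _ _; set Y := horizontal_part _ _ _ _ _.
  have hX : horizontal alpha1 alpha2 X by exact: horizontal_part_horizontal.
  have hY : horizontal alpha1 alpha2 Y by exact: horizontal_part_horizontal.
  have := codazzi_horizontal hD gZ1 e11 e21 RicE hX hY.
  rewrite codazzi => /(congr1 (fun f : smoothfun M => f x)) /esym/eqP.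
  rewrite smoothfunME smoothfunDE mulf_eq0 (negbTE bx) /= -mulr2n.
  by rewrite mulrn_eq0 /= => /eqP.
have [V /eqP[]] := volume x.
apply: wedge_zero_at_l; apply: wedge_zero_at_l; apply: wedge_zero_at_r.
exact: wedge_pow_zero_at.
Qed.
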